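(* Let $n$ and $i$ be integers $\geq 2$ with $i$ odd, and $F$ any field. Let $y_n$ be an element in the kernel of $\tau_i:K^M_*(F)\to K^M_*(F)$, $x\mapsto\{-1\}^{i-1}\cdot x$, which is of $2$-torsion (i.e. $2y_n=0$). Then, for symbols $s_1,\ldots,s_l$ in $K^M_i(F)$, the formula $$(y_n\cdot\gamma_n)(s_1+\cdots+s_l)=y_n\cdot\sum_{1\leq l_1<\cdots<l_n\leq l}s_{l_1}\cdot\ldots\cdot s_{l_n}$$ gives a well-defined map $K^M_i(F)\to K^M_*(F)$ (i.e. the right-hand side depends only on the element $s_1+\cdots+s_l$ of $K^M_i(F)$).
   Context: $K^M_*(F)=\bigoplus_{n\ge0}K^M_n(F)$ is the (integral) Milnor $K$-ring of $F$: the tensor algebra of the abelian group $F^\times$ modulo the ideal generated by the $a\otimes(1-a)$, $a\neq0,1$. The class of $a_1\otimes\cdots\otimes a_i$ is the symbol $\{a_1,\ldots,a_i\}\in K^M_i(F)$. Every element of $K^M_i(F)$ is a sum of symbols. *)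

(* Defs.v *)
From HB Require Import structures.
From mathcomp Require Import all_boot all_order all_algebra.
From mathcomp Require Import boolp.
From mathcomp Require Import monalg.

Set Implicit Arguments.
Unset Strict Implicit.
Unset Printing Implicit Defensive.

Import GRing.Theory.
Local Open Scope ring_scope.
Local Open Scope quotient_scope.

Inductive subgroup_gen (V : zmodType) (S : V -> Prop) : V -> Prop :=
| subgroup_gen0 : subgroup_gen S 0
| subgroup_genB x y :
    subgroup_gen S x -> subgroup_gen S y -> subgroup_gen S (x - y)
| subgroup_gen_mem x : S x -> subgroup_gen S x.

Inductive ideal_gen (R : pzRingType) (S : R -> Prop) : R -> Prop :=
| ideal_gen0 : ideal_gen S 0
| ideal_genB x y : ideal_gen S x -> ideal_gen S y -> ideal_gen S (x - y)
| ideal_genM a x b : ideal_gen S x -> ideal_gen S (a * x * b)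
| ideal_gen_mem x : S x -> ideal_gen S x.

(* The quotient of a possibly non-commutative ring by the two-sided ideal
   generated by [S]. The ideal may be improper, hence [pzRingType]. *)
Section RingQuot.
Variables (R : pzRingType) (S : R -> Prop).

Definition ideal_pred : {pred R} := fun x => `[< ideal_gen S x >].

Fact ideal_pred_zmod_closed : zmod_closed ideal_pred.
Proof.
split; first by apply/asboolP; apply: ideal_gen0.
by move=> x y /asboolP Ix /asboolP Iy; apply/asboolP; apply: ideal_genB.
Qed.

HB.instance Definition _ :=
  GRing.isZmodClosed.Build R ideal_pred ideal_pred_zmod_closed.

Definition ring_quot : Type := Quotient.quot ideal_pred.

HB.instance Definition _ := GRing.Zmodule.on ring_quot.

Definition ring_quot_pi (x : R) : ring_quot := \pi_(Quotient.quot ideal_pred) x.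

Definition ring_quot_repr (u : ring_quot) : R :=
  repr (u : Quotient.quot ideal_pred).

Lemma ring_quot_piP x y :
  reflect (ideal_gen S (x - y)) (ring_quot_pi x == ring_quot_pi y).
Proof.
apply: (iffP idP); rewrite /ring_quot_pi -Quotient.idealrBE.
  by move/asboolP.
by move=> Ixy; apply/asboolP.
Qed.

Lemma ring_quot_pi_eq0 x : ring_quot_pi x = 0 <-> ideal_gen S x.
Proof.
have pi0 : ring_quot_pi 0 = 0 by rewrite /ring_quot_pi !piE.
rewrite -pi0; split; first by move/eqP/ring_quot_piP; rewrite subr0.
by move=> Ix; apply/eqP/ring_quot_piP; rewrite subr0.
Qed.

Lemma ring_quot_reprK u : ring_quot_pi (ring_quot_repr u) = u.
Proof. exact: reprK. Qed.

Lemma ring_quot_pi_surj u : exists x, u = ring_quot_pi x.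
Proof. by exists (ring_quot_repr u); rewrite ring_quot_reprK. Qed.

Definition ring_quot_oneq : ring_quot := ring_quot_pi 1.
Definition ring_quot_mulq (u v : ring_quot) : ring_quot :=
  ring_quot_pi (ring_quot_repr u * ring_quot_repr v).

Fact ring_quot_piB : {morph ring_quot_pi : x y / x - y}.
Proof. by move=> x y; rewrite /ring_quot_pi !piE. Qed.

Fact ring_quot_piD : {morph ring_quot_pi : x y / x + y}.
Proof. by move=> x y; rewrite /ring_quot_pi !piE. Qed.

Fact ring_quot_piM x y :
  ring_quot_pi (x * y) = ring_quot_mulq (ring_quot_pi x) (ring_quot_pi y).
Proof.
apply/eqP/ring_quot_piP.
set x' := ring_quot_repr (ring_quot_pi x).
set y' := ring_quot_repr (ring_quot_pi y).
have Ix : ideal_gen S (x - x').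
  by apply/ring_quot_piP; rewrite ring_quot_reprK.
have Iy : ideal_gen S (y' - y).
  by apply/ring_quot_piP; rewrite ring_quot_reprK.
have -> : x * y - x' * y' = 1 * (x - x') * y - x' * (y' - y) * 1.
  by rewrite mul1r mulr1 mulrBl mulrBr opprB addrA subrK.
by apply: ideal_genB; apply: ideal_genM.
Qed.

Fact ring_quot_mulqA : associative ring_quot_mulq.
Proof.
move=> u v w; have [x ->] := ring_quot_pi_surj u.
have [y ->] := ring_quot_pi_surj v; have [z ->] := ring_quot_pi_surj w.
by rewrite -!ring_quot_piM mulrA.
Qed.

Fact ring_quot_mul1q : left_id ring_quot_oneq ring_quot_mulq.
Proof.
by move=> u; have [x ->] := ring_quot_pi_surj u; rewrite -ring_quot_piM mul1r.
Qed.

Fact ring_quot_mulq1 : right_id ring_quot_oneq ring_quot_mulq.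
Proof.
by move=> u; have [x ->] := ring_quot_pi_surj u; rewrite -ring_quot_piM mulr1.
Qed.

Fact ring_quot_mulqDl : left_distributive ring_quot_mulq +%R.
Proof.
move=> u v w; have [x ->] := ring_quot_pi_surj u.
have [y ->] := ring_quot_pi_surj v; have [z ->] := ring_quot_pi_surj w.
by rewrite -ring_quot_piD -!ring_quot_piM -ring_quot_piD mulrDl.
Qed.

Fact ring_quot_mulqDr : right_distributive ring_quot_mulq +%R.
Proof.
move=> u v w; have [x ->] := ring_quot_pi_surj u.
have [y ->] := ring_quot_pi_surj v; have [z ->] := ring_quot_pi_surj w.
by rewrite -ring_quot_piD -!ring_quot_piM -ring_quot_piD mulrDr.
Qed.

HB.instance Definition _ := GRing.Zmodule_isPzRing.Build ring_quot
  ring_quot_mulqA ring_quot_mul1q ring_quot_mulq1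
  ring_quot_mulqDl ring_quot_mulqDr.

HB.instance Definition _ :=
  GRing.isZmodMorphism.Build R ring_quot ring_quot_pi ring_quot_piB.

Fact ring_quot_pi_monoid_morphism : monoid_morphism ring_quot_pi.
Proof. by split; [|exact: ring_quot_piM]. Qed.

HB.instance Definition _ :=
  GRing.isMonoidMorphism.Build R ring_quot ring_quot_pi
    ring_quot_pi_monoid_morphism.

End RingQuot.

(* The tensor algebra of an abelian group [A]: the free ring Z<A> on the
   underlying set of [A] (integer combinations of words in [A], multiplied by
   concatenation), modulo the additivity of the generators. *)
Section TensorAlgebra.
Variable A : zmodType.

Definition free_ring : Type := {malg int[{fmonom A}]}.
HB.instance Definition _ := GRing.NzRing.on free_ring.

Definition free_gen (a : A) : free_ring := << fmu a >>.

Definition tensor_rel (z : free_ring) : Prop :=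
  exists a b, z = free_gen (a + b) - free_gen a - free_gen b.

Definition tensor_algebra : Type := ring_quot tensor_rel.
HB.instance Definition _ := GRing.PzRing.on tensor_algebra.

Definition tensor_gen (a : A) : tensor_algebra :=
  ring_quot_pi tensor_rel (free_gen a).

Definition pure_tensor (s : seq A) : tensor_algebra :=
  \prod_(a <- s) tensor_gen a.

Definition tensor_power (n : nat) : tensor_algebra -> Prop :=
  subgroup_gen (fun t => exists s : n.-tuple A, t = pure_tensor s).

Lemma tensor_genD a b : tensor_gen (a + b) = tensor_gen a + tensor_gen b.
Proof.
apply/eqP; rewrite -subr_eq0 opprD addrA -!rmorphB; apply/eqP.
by apply/ring_quot_pi_eq0; apply: ideal_gen_mem; exists a, b.
Qed.

End TensorAlgebra.

(* The group F^*, written additively so that it is a [zmodType]: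
   [a + b : Fstar F] is the product of [a] and [b] in [F]. *)
Section Units.
Variable F : fieldType.

Definition Fstar : Type := {a : F | a != 0}.
HB.instance Definition _ := Choice.on Fstar.

Implicit Types a b : Fstar.

Definition Fstar_one : Fstar := exist _ 1 (oner_neq0 F).
Fact Fstar_m1_subproof : (-1 : F) != 0.
Proof. by rewrite oppr_eq0 oner_neq0. Qed.
Definition Fstar_m1 : Fstar := exist _ (-1) Fstar_m1_subproof.

Fact Fstar_mul_subproof a b : sval a * sval b != 0.
Proof. exact: mulf_neq0 (valP a) (valP b). Qed.
Definition Fstar_mul a b : Fstar := exist _ (sval a * sval b) (Fstar_mul_subproof a b).

Fact Fstar_inv_subproof a : (sval a)^-1 != 0.
Proof. by rewrite invr_eq0 (valP a). Qed.
Definition Fstar_inv a : Fstar := exist _ (sval a)^-1 (Fstar_inv_subproof a).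

Fact Fstar_mulA : associative Fstar_mul.
Proof. by move=> a b c; apply: val_inj; rewrite /= mulrA. Qed.
Fact Fstar_mulC : commutative Fstar_mul.
Proof. by move=> a b; apply: val_inj; rewrite /= mulrC. Qed.
Fact Fstar_mul1 : left_id Fstar_one Fstar_mul.
Proof. by move=> a; apply: val_inj; rewrite /= mul1r. Qed.
Fact Fstar_mulV : left_inverse Fstar_one Fstar_inv Fstar_mul.
Proof. by move=> a; apply: val_inj; rewrite /= mulVf ?(valP a). Qed.

HB.instance Definition _ := GRing.isZmodule.Build Fstar
  Fstar_mulA Fstar_mulC Fstar_mul1 Fstar_mulV.

End Units.

Section MilnorK.
Variable F : fieldType.

(* If [a : Fstar F] and [1 - a] both lie in F^*, then [a] is neither 0 nor 1. *)
Definition steinberg_rel (z : tensor_algebra (Fstar F)) : Prop :=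
  exists a b : Fstar F, sval b = 1 - sval a /\ z = tensor_gen a * tensor_gen b.

Definition milnorK : Type := ring_quot steinberg_rel.
HB.instance Definition _ := GRing.PzRing.on milnorK.

Definition symbol (s : seq (Fstar F)) : milnorK :=
  ring_quot_pi steinberg_rel (pure_tensor s).

Lemma symbol_cat s t : symbol (s ++ t) = symbol s * symbol t.
Proof. by rewrite /symbol /pure_tensor big_cat rmorphM. Qed.

Lemma symbolD s a b t :
  symbol (s ++ (a + b) :: t) = symbol (s ++ a :: t) + symbol (s ++ b :: t).
Proof.
rewrite /symbol /pure_tensor !big_cat /= !big_cons tensor_genD.
by rewrite mulrDl mulrDr rmorphD.
Qed.

Lemma steinberg a b : sval b = 1 - sval a -> symbol [:: a; b] = 0.
Proof.
move=> ab; rewrite /symbol /pure_tensor !big_cons big_nil mulr1.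
by apply/ring_quot_pi_eq0; apply: ideal_gen_mem; exists a, b.
Qed.

Definition milnorK_deg (n : nat) : {pred milnorK} := fun x =>
  `[< exists2 t, tensor_power n t & x = ring_quot_pi steinberg_rel t >].

Fact milnorK_deg_zmod_closed n : zmod_closed (milnorK_deg n).
Proof.
split; first by apply/asboolP; exists 0; [exact: subgroup_gen0|rewrite rmorph0].
move=> x y /asboolP[t Tt ->] /asboolP[u Tu ->]; apply/asboolP.
by exists (t - u); [exact: subgroup_genB|rewrite rmorphB].
Qed.

HB.instance Definition _ n :=
  GRing.isZmodClosed.Build milnorK (milnorK_deg n) (milnorK_deg_zmod_closed n).

Record milnorKn (n : nat) : predArgType :=
  MilnorKn { milnorKn_val :> milnorK; _ : milnorKn_val \in milnorK_deg n }.

HB.instance Definition _ n := [isSub for @milnorKn_val n].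
HB.instance Definition _ n := [Choice of milnorKn n by <:].
HB.instance Definition _ n :=
  [SubChoice_isSubZmodule of milnorKn n by <:].

Definition is_symbol (n : nat) (x : milnorKn n) : Prop :=
  exists a : n.-tuple (Fstar F), milnorKn_val x = symbol a.

Definition tau (i : nat) (x : milnorK) : milnorK :=
  symbol [:: Fstar_m1 F] ^+ i.-1 * x.

End MilnorK.

(* Main.v *)
From HB Require Import structures.
Require Import Defs.
From mathcomp Require Import all_boot all_order all_algebra.
From mathcomp Require Import finmap monalg.
From mathcomp Require boolp mpoly.

Set Implicit Arguments.
Unset Strict Implicit.
Unset Printing Implicit Defensive.

Import GRing.Theory.
Local Open Scope ring_scope.

(** Write T for a formal variable and {a} for the degree-one symbol of a unit
    a. The elements [gamma_n (s_1 + ... + s_l)] are the coefficients of the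
    product of the [1 + s_j T], so well-definedness amounts to saying that
    [s |-> 1 + s T] extends to a group morphism from sums of symbols, written
    additively, to power series with constant term 1, written multiplicatively.

    By [milnorK_additive_lift], a morphism out of the additive group of the
    Milnor ring is the same as a function on lists of units that is additive in
    each entry and vanishes on lists with two adjacent entries a, 1 - a. For
    [s |-> 1 + s T], the vanishing holds because a symbol with such entries is
    zero. Additivity in an entry requires [s s' = 0] whenever s and s' are
    symbols of degree i that differ in one entry only: then
    [(1 + s T)(1 + s' T) = 1 + (s + s') T]. From {a}{a} = {a}{-1} one gets, up
    to sign, [s s' = {a}{b} w w = {a}{b} {-1}^(i-1) w], where w is the symbol
    of the i - 1 common entries. So everything works in a commutative ring
    receiving the Milnor ring in which 2 and {-1}^(i-1) vanish
    ([divided_power_exists]).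

    Such a ring is the quotient Q of the Milnor ring by the ideal generated by
    2 and {-1}^(i-1): symbols of degree one anticommute ([symbol_anticomm]),
    hence Q is commutative ([milnorK_comm_mod2]). Both generators are central
    and are killed by y, so y kills the whole ideal
    ([two_m1_rel_annihilates]), and multiplication by y factors through Q. The
    required map is y times the divided power with values in Q. It is unique
    because each element of the degree i part is a sum of symbols: an opposite
    is again a symbol, as its first entry may be inverted. *)

(** * Additive maps out of quotient rings and free rings *)

Section RingQuotLift.
Variables (R : pzRingType) (S : R -> Prop) (G : zmodType).
Variable phi : {additive R -> G}.

(** The two-sided multiples of S generate the ideal as an additive group; the
    induction carries the outer factors a and b along so that the step for
    multiples goes through. *)
Lemma ideal_gen_additive0 :
  (forall a x b, S x -> phi (a * x * b) = 0) ->
  forall x, ideal_gen S x -> phi x = 0.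
Proof.
move=> phiS x Ix.
suff: forall a b, phi (a * x * b) = 0 by move/(_ 1 1); rewrite mul1r mulr1.
elim: {x} Ix => [|x y _ IHx _ IHy|c x d _ IHx|x Sx] a b.
- by rewrite mulr0 mul0r raddf0.
- by rewrite mulrBr mulrBl raddfB IHx IHy subr0.
- by rewrite !mulrA -(mulrA _ d); apply: IHx.
- exact: phiS.
Qed.

Lemma ring_quot_additive_lift :
  (forall a x b, S x -> phi (a * x * b) = 0) ->
  exists psi : {additive ring_quot S -> G},
    forall x, psi (ring_quot_pi S x) = phi x.
Proof.
move=> phiS; pose psi (u : ring_quot S) := phi (ring_quot_repr u).
have psiE x : psi (ring_quot_pi S x) = phi x.
  apply/eqP; rewrite -subr_eq0 -raddfB; apply/eqP.
  apply: (ideal_gen_additive0 phiS).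
  by apply/ring_quot_piP; rewrite ring_quot_reprK.
have psiB : zmod_morphism psi.
  move=> u v; have [x ->] := ring_quot_pi_surj u.
  by have [y ->] := ring_quot_pi_surj v; rewrite -rmorphB !psiE raddfB.
pose H := GRing.isZmodMorphism.Build _ _ psi psiB.
by exists (HB.pack psi H : {additive ring_quot S -> G}).
Qed.

End RingQuotLift.

(** The free ring is the free abelian group on words. *)
Section FreeRing.
Variable A : zmodType.

Definition word (w : seq A) : free_ring A := \prod_(a <- w) free_gen a.

Lemma word_malgE w : word w = << FMonom w >> :> {malg int[{fmonom A}]}.
Proof.
rewrite /word; elim: w => [|a w IH]; first by rewrite big_nil -fmE.
rewrite big_cons IH -[_ * _]/(fgmul _ _) fgmulUU mulr1 fmuE.
by congr << _ >>; apply/val_inj; rewrite /= /mmul/= /fmmul fmE.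
Qed.

Lemma free_ringE (x : free_ring A) :
  x = \sum_(m <- msupp x) word (fmonom_val m) *~ x@_m.
Proof.
rewrite {1}[x]monalgE; apply: eq_bigr => m _.
rewrite word_malgE; have <- : FMonom (fmonom_val m) = m by case: m.
by rewrite -(raddfMz (mkmalgU (FMonom (fmonom_val m)))) /= intz.
Qed.

Lemma free_ring_additive0 (G : zmodType) (phi : {additive free_ring A -> G}) :
  (forall w, phi (word w) = 0) -> forall x, phi x = 0.
Proof.
move=> phi0 x; rewrite [x]free_ringE raddf_sum big1 // => m _.
by rewrite raddfMz phi0 mul0rz.
Qed.

Lemma free_ring_additive_lift (G : zmodType) (g : seq A -> G) :
  exists phi : {additive free_ring A -> G}, forall w, phi (word w) = g w.
Proof.
pose phi (x : free_ring A) := \sum_(m <- msupp x) g (fmonom_val m) *~ x@_m.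
(* Supports must be enlarged to a common one before comparing sums. *)
have phiEw (d : {fset {fmonom A}}) x : (msupp x `<=` d)%fset ->
    phi x = \sum_(m <- d) g (fmonom_val m) *~ x@_m.
  move=> le; rewrite /phi (big_fset_incl _ le) // => m _ /mcoeff_outdom ->.
  by rewrite mulr0z.
have phiB : zmod_morphism phi.
  move=> x y; pose d := (msupp x `|` msupp y)%fset.
  rewrite (phiEw d (x - y)) ?msuppB_le // (phiEw d x) ?fsubsetUl //.
  rewrite (phiEw d y) ?fsubsetUr // -sumrB; apply: eq_bigr => m _.
  by rewrite mcoeffB mulrzBr.
pose H := GRing.isZmodMorphism.Build _ _ phi phiB.
exists (HB.pack phi H : {additive free_ring A -> G}) => w /=.
rewrite word_malgE (phiEw [fset FMonom w]%fset) ?msuppU1 //.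
by rewrite big_seq_fset1 mcoeffUU mulr1z.
Qed.

End FreeRing.

(** * The additive group of the Milnor ring *)

Section MilnorLift.
Variable F : fieldType.
Local Notation A := (Fstar F).

Lemma symbolE (w : seq A) :
  symbol w = ring_quot_pi (@steinberg_rel F) (ring_quot_pi (@tensor_rel A) (word w)).
Proof. by rewrite /symbol /pure_tensor /word !rmorph_prod. Qed.

(** Symbols of all lengths at once: the induction principle used for every
    identity that is additive in an element of the Milnor ring. *)
Lemma milnorK_sum_symbols (x : milnorK F) :
  subgroup_gen (fun z => exists w, z = symbol w) x.
Proof.
have [t ->] := ring_quot_pi_surj x; have [u ->] := ring_quot_pi_surj t.
set P := subgroup_gen _; have PB y z : P y -> P z -> P (y - z).
  exact: subgroup_genB.
have P0 : P 0 by exact: subgroup_gen0.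
have PN y : P y -> P (- y) by rewrite -[- y]sub0r; apply: PB.
have PD y z : P y -> P z -> P (y + z).
  by move=> Py /PN; rewrite -{2}[z]opprK; apply: PB.
rewrite [u]free_ringE !raddf_sum /=; apply: big_ind => // m _.
rewrite !raddfMz /= -symbolE.
have Pn k : P (symbol (fmonom_val m) *+ k).
  elim: k => [|k IH]; first by rewrite mulr0n.
  by rewrite mulrS; apply: PD => //; apply: subgroup_gen_mem; exists (fmonom_val m).
by case: (u@_m) => k; [exact: Pn|apply: PN; exact: Pn].
Qed.

(** The universal property of the Milnor ring as an abelian group. The two
    hypotheses say that g kills the two-sided multiples, by words, of the
    relations of the tensor algebra and of the Steinberg relations; g
    therefore descends through the two successive quotients. *)
Lemma milnorK_additive_lift (G : zmodType) (g : seq A -> G) :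
    (forall u a b v, g (u ++ (a + b) :: v) = g (u ++ a :: v) + g (u ++ b :: v)) ->
    (forall u (a b : A) v, sval b = 1 - sval a -> g (u ++ a :: b :: v) = 0) ->
  exists phi : {additive milnorK F -> G}, forall w, phi (symbol w) = g w.
Proof.
move=> gD gS; have [f fE] := free_ring_additive_lift g.
have wcat u v : word u * word v = word (u ++ v) :> free_ring A.
  by rewrite /word big_cat.
have wgen a : free_gen a = word [:: a] by rewrite /word big_seq1.
(* By bilinearity the two-sided multiples need only be tested on words. *)
have two_sided (R : pzRingType) (p : {rmorphism free_ring A -> R})
    (f' : {additive R -> G}) x :
    (forall u v, f' (p (word u) * x * p (word v)) = 0) ->
    forall a b, f' (p a * x * p b) = 0.
  move=> H a b; have H1 u c : f' (p (word u) * x * p c) = 0.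
    pose f1 := fun c => f' (p (word u) * x * p c).
    have f1B : zmod_morphism f1 by move=> y z; rewrite /f1 !raddfB mulrBr raddfB.
    pose M := GRing.isZmodMorphism.Build _ _ f1 f1B.
    exact: (@free_ring_additive0 _ _ (HB.pack f1 M)) (H u) c.
  pose f2 := fun c => f' (p c * x * p b).
  have f2B : zmod_morphism f2.
    by move=> y z; rewrite /f2 raddfB !mulrBl raddfB.
  pose M := GRing.isZmodMorphism.Build _ _ f2 f2B.
  by apply: (@free_ring_additive0 _ _ (HB.pack f2 M)) a => u; apply: H1.
have [f1 f1E] : exists f1 : {additive tensor_algebra A -> G},
    forall x, f1 (ring_quot_pi (@tensor_rel A) x) = f x.
  apply: ring_quot_additive_lift => a _ b [c [d ->]].
  apply: (two_sided _ idfun) => u v /=.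
  rewrite !mulrBr !mulrBl !raddfB /= !wgen !wcat !fE -!catA /= gD.
  by rewrite -addrA -opprD subrr.
have [f2 f2E] : exists f2 : {additive milnorK F -> G},
    forall x, f2 (ring_quot_pi (@steinberg_rel F) x) = f1 x.
  apply: ring_quot_additive_lift => a _ b [c [d [cd ->]]].
  have [a0 ->] := ring_quot_pi_surj a; have [b0 ->] := ring_quot_pi_surj b.
  apply: two_sided => u v; rewrite /tensor_gen -(rmorphM _ (free_gen c)).
  rewrite -(rmorphM _ (word u)) -(rmorphM _ (word u * _)) f1E.
  by rewrite !wgen !wcat fE -!catA; apply: gS.
by exists f2 => w; rewrite symbolE f2E f1E fE.
Qed.

End MilnorLift.

(** * Relations between symbols *)

Section SymbolRelations.
Variable F : fieldType.
Local Notation "{{ a }}" := (symbol [:: a : Fstar F]) (format "{{ a }}").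
Local Notation m1 := (Fstar_m1 F).
Implicit Types a b : Fstar F.

Lemma symbol1D a b : {{a + b}} = {{a}} + {{b}}.
Proof. exact: (symbolD [::] a b [::]). Qed.

Lemma symbol1B a b : {{a - b}} = {{a}} - {{b}}.
Proof. by apply/(addIr {{b}}); rewrite -symbol1D !subrK. Qed.

Lemma symbol1_0 : {{0}} = 0.
Proof. by rewrite -(subrr 0) symbol1B subrr. Qed.

Lemma symbol1N a : {{- a}} = - {{a}}.
Proof. by rewrite -sub0r symbol1B symbol1_0 sub0r. Qed.

Lemma symbol_cons a w : symbol (a :: w) = {{a}} * symbol w.
Proof. by rewrite -symbol_cat. Qed.

Lemma symbol_nil : symbol [::] = 1 :> milnorK F.
Proof. by rewrite /symbol /pure_tensor big_nil rmorph1. Qed.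

Lemma symbol_prod w : symbol w = \prod_(a <- w) {{a}}.
Proof.
by elim: w => [|a w IH]; rewrite ?big_nil ?symbol_nil // big_cons -IH symbol_cons.
Qed.

Lemma Fstar_m1D_m1 : m1 + m1 = 0.
Proof. by apply: val_inj; rewrite /= mulrNN mulr1. Qed.

Lemma symbol_m1N : - {{m1}} = {{m1}}.
Proof.
by apply/eqP; rewrite -subr_eq0 -opprD -symbol1D Fstar_m1D_m1 symbol1_0 oppr0.
Qed.

(** In field notation {a}{-a} = 0: write -a = (1 - a) / (1 - 1/a), and apply
    the Steinberg relation to a and to 1/a. *)
Lemma symbol_mulN a : {{a}} * {{m1 + a}} = 0.
Proof.
have [->|a_neq0] := eqVneq a 0; first by rewrite symbol1_0 mul0r.
have va1 : sval a != 1.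
  by apply: contra a_neq0 => /eqP va1; apply/eqP/val_inj.
have vb : 1 - sval a != 0 by rewrite subr_eq0 eq_sym.
have vc : 1 - (sval a)^-1 != 0 by rewrite subr_eq0 eq_sym invr_eq1.
pose b : Fstar F := exist (fun x : F => x != 0) _ vb.
pose c : Fstar F := exist (fun x : F => x != 0) _ vc.
have -> : m1 + a = b - c.
  apply/(addIr c); rewrite subrK; apply: val_inj => /=.
  by rewrite mulN1r mulNr mulrBr mulr1 divff ?(valP a) // opprB.
have ab0 : {{a}} * {{b}} = 0 by rewrite -symbol_cat /= steinberg.
have ac0 : {{- a}} * {{c}} = 0 by rewrite -symbol_cat /= steinberg.
by rewrite symbol1B mulrBr ab0 sub0r -mulNr -symbol1N.
Qed.

Lemma symbol_sqr a : {{a}} * {{a}} = {{a}} * {{m1}}.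
Proof.
have /eqP := symbol_mulN a; rewrite symbol1D mulrDr addrC addr_eq0 => /eqP ->.
by rewrite -mulrN symbol_m1N.
Qed.

Lemma symbol_anticomm a b : {{a}} * {{b}} = - ({{b}} * {{a}}).
Proof.
(* The relation x x = x m is quadratic in x; it is polarized at x + y. *)
have polarize (R : pzRingType) (x y m : R) : x * x = x * m -> y * y = y * m ->
    (x + y) * (x + y) = (x + y) * m -> x * y = - (y * x).
  move=> xx yy; rewrite mulrDr !mulrDl xx yy -addrA => /addrI.
  rewrite addrA -[RHS]add0r => /addIr /eqP.
  by rewrite addrC addr_eq0 => /eqP.
by apply: (polarize _ _ _ {{m1}}); rewrite -?symbol1D symbol_sqr.
Qed.

Lemma symbol_m1_central (x : milnorK F) : GRing.comm {{m1}} x.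
Proof.
elim: (milnorK_sum_symbols x) => {x} [|x y _ Hx _ Hy|_ [w ->]].
- exact: commr0.
- exact: commrB Hx Hy.
rewrite (symbol_prod w); apply: commr_prod => a _.
by rewrite /GRing.comm symbol_anticomm -mulrN symbol_m1N.
Qed.

(** Symbols of degree one anticommute, hence commute once 2 = 0, and they
    generate the ring. *)
Lemma milnorK_comm_mod2 (B : pzRingType) (h : {rmorphism milnorK F -> B}) :
  2%:R = 0 :> B -> forall x y, h x * h y = h y * h x.
Proof.
move=> B2 x y; have BN (z : B) : - z = z.
  by apply/eqP; rewrite eq_sym -subr_eq0 opprK -mulr2n -mulr_natl B2 mul0r.
have commS a b : GRing.comm (h {{a}}) (h {{b}}).
  rewrite /GRing.comm -(rmorphM h {{a}}) -(rmorphM h {{b}}).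
  by rewrite (symbol_anticomm a b) rmorphN BN.
have commW v w : GRing.comm (h (symbol v)) (h (symbol w)).
  rewrite (symbol_prod v) (symbol_prod w) !rmorph_prod.
  apply: commr_prod => a _.
  by apply/commr_sym/commr_prod => b _.
elim: (milnorK_sum_symbols x) => {x} [|x z _ Hx _ Hz|_ [v ->]].
- by rewrite rmorph0 mul0r mulr0.
- by rewrite rmorphB mulrBl mulrBr Hx Hz.
elim: (milnorK_sum_symbols y) => {y} [|y z _ Hy _ Hz|_ [w ->]].
- by rewrite rmorph0 mul0r mulr0.
- by rewrite rmorphB mulrBl mulrBr Hy Hz.
exact: commW.
Qed.

End SymbolRelations.

(** * Generating polynomials *)

Section ElementarySymmetric.
Import mpoly.
Variable C : comNzRingType.

Lemma coef_prod_1DX (l n : nat) (c : 'I_l -> C) :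
  (\prod_(j < l) (1 + (c j)%:P * 'X))`_n =
  \sum_(t : n.-tuple 'I_l | sorted (fun j k : 'I_l => (j < k)%N) t)
     \prod_(j <- t) c j.
Proof.
transitivity (\sum_(J : {set 'I_l} | #|J| == n) \prod_(j in J) c j); last first.
  (* Both sides are the n-th elementary symmetric polynomial at c. *)
  have := congr1 (meval c) (mesym_tupleE l C n).
  rewrite /mesym !raddf_sum /=.
  under eq_bigr => J _ do
    (rewrite rmorph_prod /=; under eq_bigr => j _ do rewrite mevalXU).
  move=> ->; apply: eq_big => [t|t _]; first by rewrite /tmono sorted_map.
  by rewrite rmorph_prod /=; apply: eq_bigr => j _; rewrite mevalXU.
under eq_bigr do rewrite addrC.
rewrite bigA_distr coef_sum [RHS]big_mkcond; apply: eq_bigr => J _.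
rewrite -big_mkcond /= big_split /= prodr_const -rmorph_prod coefCM coefXn.
by rewrite eq_sym; case: eqP; rewrite ?mulr1 ?mulr0.
Qed.

End ElementarySymmetric.

Section PolyInvolution.
Variable C : comNzRingType.

(** Once 2 = 0 and s s = 0, the polynomial 1 + s T is its own inverse. This
    group of units contains all products of such polynomials and spares power
    series. *)
Definition poly_involution : Type := {p : {poly C} | p * p == 1}.
HB.instance Definition _ := Choice.on poly_involution.
Implicit Types p q r : poly_involution.

Fact poly_involution_one_subproof : (1 : {poly C}) * 1 == 1.
Proof. by rewrite mulr1. Qed.
Definition poly_involution_one : poly_involution :=
  exist _ 1 poly_involution_one_subproof.

Fact poly_involution_mul_subproof p q : (sval p * sval q) * (sval p * sval q) == 1.
Proof. by rewrite mulrACA (eqP (valP p)) (eqP (valP q)) mulr1. Qed.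
Definition poly_involution_mul p q : poly_involution :=
  exist _ (sval p * sval q) (poly_involution_mul_subproof p q).

Fact poly_involution_mulA : associative poly_involution_mul.
Proof. by move=> p q r; apply: val_inj; rewrite /= mulrA. Qed.
Fact poly_involution_mulC : commutative poly_involution_mul.
Proof. by move=> p q; apply: val_inj; rewrite /= mulrC. Qed.
Fact poly_involution_mul1 : left_id poly_involution_one poly_involution_mul.
Proof. by move=> p; apply: val_inj; rewrite /= mul1r. Qed.
Fact poly_involution_mulV : left_inverse poly_involution_one id poly_involution_mul.
Proof. by move=> p; apply: val_inj; rewrite /= (eqP (valP p)). Qed.

HB.instance Definition _ := GRing.isZmodule.Build poly_involution
  poly_involution_mulA poly_involution_mulC poly_involution_mul1
  poly_involution_mulV.

Lemma sval_poly_involution_sum (I : Type) (r : seq I) (f : I -> poly_involution) :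
  sval (\sum_(j <- r) f j) = \prod_(j <- r) sval (f j).
Proof. by elim/big_ind2: _ => // p1 p2 q1 q2 <- <-. Qed.

End PolyInvolution.

(** * Divided powers modulo 2 and a power of {-1} *)

Section DividedPower.
Variables (F : fieldType) (C : comNzRingType) (h : {rmorphism milnorK F -> C}).
Variable i : nat.
Hypothesis C2 : 2%:R = 0 :> C.
Local Notation rho a := (h (symbol [:: a])).
Hypothesis Cm1 : rho (Fstar_m1 F) ^+ i.-1 = 0.

Lemma image_cat u v : h (symbol (u ++ v)) = h (symbol u) * h (symbol v).
Proof. by rewrite symbol_cat rmorphM. Qed.

Lemma image_cons a w : h (symbol (a :: w)) = rho a * h (symbol w).
Proof. exact: (image_cat [:: a]). Qed.

(** The relation {a}{a} = {a}{-1} applied to each entry of w. *)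
Lemma symbol_image_sqr w :
  h (symbol w) * h (symbol w) = h (symbol w) * rho (Fstar_m1 F) ^+ size w.
Proof.
elim: w => [|a w IH]; first by rewrite expr0 !symbol_nil rmorph1 mulr1.
have sqr_a : rho a * rho a = rho a * rho (Fstar_m1 F).
  by rewrite -(rmorphM h (symbol [:: a]) (symbol [:: a])) symbol_sqr rmorphM.
by rewrite image_cons mulrACA IH sqr_a mulrACA -exprS.
Qed.

Lemma symbol_image_sqr0 w : (i.-1 <= size w)%N -> h (symbol w) * h (symbol w) = 0.
Proof.
by move=> le; rewrite symbol_image_sqr -(subnK le) exprD Cm1 !mulr0.
Qed.

Lemma one_plusT_mul (x y : C) : x * y = 0 ->
  1 + (x + y)%:P * 'X = (1 + x%:P * 'X) * (1 + y%:P * 'X).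
Proof.
move=> xy0; rewrite mulrDl mul1r mulrDr mulr1 mulrACA -polyCM xy0 polyC0 mul0r.
by rewrite addr0 polyCD mulrDl addrA addrAC.
Qed.

Fact one_plus_symbolT_subproof w :
  let p := if size w == i then 1 + (h (symbol w))%:P * 'X else 1 in p * p == 1.
Proof.
case: eqP => [szw|_] /=; last by rewrite mulr1.
rewrite -one_plusT_mul ?symbol_image_sqr0 ?szw ?leq_pred //.
by rewrite -mulr2n -mulr_natl C2 mul0r polyC0 mul0r addr0.
Qed.

(** Lists of other lengths go to the trivial polynomial, so that the function
    is defined on all symbols and only the degree i part contributes. *)
Definition one_plus_symbolT w : poly_involution C :=
  exist (fun p : {poly C} => p * p == 1) _ (one_plus_symbolT_subproof w).

Lemma one_plus_symbolT_size w :
  size w = i -> sval (one_plus_symbolT w) = 1 + (h (symbol w))%:P * 'X.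
Proof. by move=> szw; rewrite /= szw eqxx. Qed.

Lemma one_plus_symbolT_nsize w : size w != i -> one_plus_symbolT w = 0.
Proof. by move=> szw; apply: val_inj; rewrite /= (negbTE szw). Qed.

(** The product of the two symbols on the right contains the square of the
    symbol of the i - 1 entries u ++ v, which is zero by [symbol_image_sqr0].
    This is where the exponent i - 1 comes from. *)
Lemma one_plus_symbolT_additive u a b v :
  one_plus_symbolT (u ++ (a + b) :: v) =
  one_plus_symbolT (u ++ a :: v) + one_plus_symbolT (u ++ b :: v).
Proof.
have sz c : size (u ++ c :: v) = (size (u ++ v)).+1.
  by rewrite !size_cat addnS.
have [szi|nszi] := eqVneq (size (u ++ v)).+1 i; last first.
  by rewrite !one_plus_symbolT_nsize ?sz // addr0.
apply: val_inj; rewrite /= !sz szi eqxx.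
rewrite symbolD rmorphD; apply: one_plusT_mul.
have E c : h (symbol (u ++ c :: v)) = rho c * h (symbol (u ++ v)).
  by rewrite !image_cat image_cons mulrCA.
by rewrite !E mulrACA symbol_image_sqr0 ?mulr0 // -szi.
Qed.

Lemma divided_power_exists n :
  exists gamma : milnorK F -> C, forall (l : nat) (s : 'I_l -> milnorK F),
    (forall j, exists a : i.-tuple (Fstar F), s j = symbol a) ->
    gamma (\sum_(j < l) s j) =
      \sum_(t : n.-tuple 'I_l | sorted (fun j k : 'I_l => (j < k)%N) t)
         \prod_(j <- t) h (s j).
Proof.
have [u a b v sab|phi phiE] :=
  milnorK_additive_lift one_plus_symbolT_additive.
  have [szi|nszi] := eqVneq (size (u ++ a :: b :: v)) i; last first.
    exact: one_plus_symbolT_nsize.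
  apply: val_inj; rewrite /= szi eqxx.
  rewrite symbol_cat (symbol_cat [:: a; b] v) steinberg // mul0r mulr0.
  by rewrite rmorph0 mul0r addr0.
exists (fun x => (sval (phi x))`_n) => l s sE.
rewrite raddf_sum sval_poly_involution_sum -coef_prod_1DX.
suff -> : \prod_(j < l) sval (phi (s j)) = \prod_(j < l) (1 + (h (s j))%:P * 'X).
  by [].
apply: eq_bigr => j _; have [a ->] := sE j.
by rewrite phiE one_plus_symbolT_size ?size_tuple.
Qed.

End DividedPower.

(** * Multiplication by y *)

Section WellDefined.
Variables (F : fieldType) (i : nat) (y : milnorK F).
Hypothesis y2 : y *+ 2 = 0.
Hypothesis ytau : tau i y = 0.
Local Notation m1 := (symbol [:: Fstar_m1 F]).

Definition two_m1_rel (z : milnorK F) : Prop := z = 2%:R \/ z = m1 ^+ i.-1.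

(** Centrality of the two generators turns the right ideal of elements
    annihilated by y, which contains them, into one containing the two-sided
    ideal they generate. *)
Lemma two_m1_rel_annihilates z : ideal_gen two_m1_rel z -> y * z = 0.
Proof.
pose mul_y := fun x : milnorK F => y * x.
have mul_yB : zmod_morphism mul_y by move=> u v; exact: mulrBr.
pose M := GRing.isZmodMorphism.Build _ _ mul_y mul_yB.
apply: (@ideal_gen_additive0 _ _ _ (HB.pack mul_y M)) => a x b Sx /=.
have [x_comm yx] : (forall u, GRing.comm x u) /\ y * x = 0.
  case: Sx => ->; (split; first move=> u).
  - by apply/commr_sym/commr_nat.
  - by rewrite mulr_natr.
  - by apply/commr_sym/commrX/commr_sym/symbol_m1_central.
  - by rewrite -[RHS]ytau; apply/commrX/commr_sym/symbol_m1_central.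
by rewrite /mul_y -(x_comm a) !mulrA yx !mul0r.
Qed.

Lemma divided_power_mul_exists n :
  exists f : milnorK F -> milnorK F, forall (l : nat) (s : 'I_l -> milnorK F),
    (forall j, exists a : i.-tuple (Fstar F), s j = symbol a) ->
    f (\sum_(j < l) s j) =
      y * \sum_(t : n.-tuple 'I_l | sorted (fun j k : 'I_l => (j < k)%N) t)
            \prod_(j <- t) s j.
Proof.
pose Q := ring_quot two_m1_rel.
pose pi : {rmorphism milnorK F -> Q} := ring_quot_pi two_m1_rel.
have y_pi u v : pi u = pi v -> y * u = y * v.
  move=> /eqP /ring_quot_piP /two_m1_rel_annihilates.
  by rewrite mulrBr => /eqP; rewrite subr_eq0 => /eqP.
(* The quotient may be the zero ring, over which there are no polynomials;
   but then y is zero. *)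
have [Q0|Q1] := eqVneq (1 : Q) 0.
  have y0 : y = 0.
    by rewrite -[y]mulr1 -[RHS](mulr0 y); apply: y_pi; rewrite /pi rmorph1 rmorph0.
  by exists (fun=> 0) => l s _; rewrite y0 mul0r.
have pi2 : 2%:R = 0 :> Q.
  rewrite -(rmorph_nat pi 2); apply/ring_quot_pi_eq0.
  by apply: ideal_gen_mem; left.
have pim1 : pi m1 ^+ i.-1 = 0.
  rewrite -(rmorphXn pi); apply/ring_quot_pi_eq0.
  by apply: ideal_gen_mem; right.
have QC : commutative (@GRing.mul Q).
  move=> u v; have [a ->] := ring_quot_pi_surj u.
  have [b ->] := ring_quot_pi_surj v.
  exact: (milnorK_comm_mod2 pi pi2).
pose C : comNzRingType := HB.pack Q
  (GRing.PzSemiRing_isNonZero.Build Q Q1)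
  (GRing.PzRing_hasCommutativeMul.Build Q QC).
have [gamma gammaE] :=
  @divided_power_exists F C pi i pi2 pim1 n.
exists (fun x => y * ring_quot_repr (gamma x)) => l s sE.
apply: y_pi; apply: etrans (ring_quot_reprK _) _.
rewrite gammaE // (raddf_sum pi).
by apply: eq_bigr => t _; apply: esym (rmorph_prod pi _ _ _).
Qed.

End WellDefined.

(** * Sums of symbols of a fixed degree *)

Section SumsOfSymbols.
Variables (F : fieldType) (i : nat).
Hypothesis i_gt0 : (0 < i)%N.

Lemma milnorKn_val_sum l (s : 'I_l -> milnorKn F i) :
  milnorKn_val (\sum_(j < l) s j) = \sum_(j < l) milnorKn_val (s j).
Proof. exact: (raddf_sum val). Qed.

(** The sign is absorbed by the first entry, which exists since i > 0. *)
Lemma symbol_opp (a : i.-tuple (Fstar F)) :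
  exists b : i.-tuple (Fstar F), symbol b = - symbol a.
Proof.
case: i i_gt0 a => // k _ a; exists [tuple of - thead a :: behead a].
by rewrite [in RHS](tuple_eta a) /= symbol_cons symbol1N mulNr -symbol_cons.
Qed.

Lemma milnorKn_sum_symbols (x : milnorKn F i) :
  exists l (s : 'I_l -> milnorKn F i),
    (forall j, is_symbol (s j)) /\ x = \sum_(j < l) s j.
Proof.
have [r rE] : exists r : seq (i.-tuple (Fstar F)),
    milnorKn_val x = \sum_(a <- r) symbol a.
  have /boolp.asboolP [t Tt ->] := valP x.
  elim: Tt => {t} [|t u _ [r tE] _ [q uE]|_ [a ->]].
  - by exists [::]; rewrite big_nil rmorph0.
  - have [q' q'E] : exists q' : seq (i.-tuple (Fstar F)),
        \sum_(a <- q') symbol a = - \sum_(a <- q) symbol a.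
      elim: {uE} q => [|a q [q' q'E]]; first by exists [::]; rewrite !big_nil oppr0.
      have [b bE] := symbol_opp a; exists (b :: q').
      by rewrite !big_cons q'E bE opprD.
    by exists (r ++ q'); rewrite big_cat /= q'E -tE -uE rmorphB.
  - by exists [:: a]; rewrite big_seq1.
have symP (a : i.-tuple (Fstar F)) : symbol a \in milnorK_deg i.
  apply/boolp.asboolP; exists (pure_tensor a) => //.
  by apply: subgroup_gen_mem; exists a.
exists (size r), (fun j => MilnorKn (symP (tnth (in_tuple r) j))).
split=> [j|]; first by exists (tnth (in_tuple r) j).
apply: val_inj; rewrite [RHS]milnorKn_val_sum; apply: etrans rE _.
exact: big_tnth.
Qed.

End SumsOfSymbols.

Theorem proposition2p12 (F : fieldType) (n i : nat) (hn : (2 <= n)%N)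
  (hi : (2 <= i)%N) (hodd : odd i) (y : milnorK F)
  (hker : tau i y = 0) (htors : y *+ 2 = 0) :
  exists! f : milnorKn F i -> milnorK F,
    forall (l : nat) (s : 'I_l -> milnorKn F i),
      (forall j, is_symbol (s j)) ->
      f (\sum_(j < l) s j) =
        y * \sum_(t : n.-tuple 'I_l | sorted (fun j k : 'I_l => (j < k)%N) t)
              \prod_(j <- t) milnorKn_val (s j).
Proof.
have i_gt0 : (0 < i)%N by apply: ltnW.
have [f fE] := divided_power_mul_exists htors hker n.
exists (fun x => f (milnorKn_val x)); split=> [l s sE|g gE].
  by rewrite milnorKn_val_sum fE.
apply: boolp.funext => x; have [l [s [sE ->]]] := milnorKn_sum_symbols i_gt0 x.
by rewrite gE // milnorKn_val_sum fE.
Qed.
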